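(* There is no bicyclic graph $G$ with maximum degree $\Delta(G)\leq 3$ such that $E(G)=n$, where $n$ is the number of vertices of $G$.
   Context: A bicyclic graph is a connected simple graph with cyclomatic number $m-n+1=2$ ($m$ the number of edges, $n$ the number of vertices). For a simple graph $G$ with adjacency eigenvalues $\lambda_1,\dots,\lambda_n$, the energy is $E(G)=\sum_{i=1}^n|\lambda_i|$. *)

(* Defs.v *)
From mathcomp Require Import all_boot all_order all_algebra all_field.

Set Implicit Arguments.
Unset Strict Implicit.
Unset Printing Implicit Defensive.

Import Order.TTheory GRing.Theory Num.Theory.
Local Open Scope ring_scope.

(* A graph is a finite type T of vertices with an adjacency relation on it. *)
Definition simple_graph (T : finType) (e : rel T) : Prop :=
  symmetric e /\ irreflexive e.

Definition connected_graph (T : finType) (e : rel T) : Prop :=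
  (0 < #|T|)%N /\ forall x y : T, connect e x y.

Definition edges (T : finType) (e : rel T) : {set {set T}} :=
  [set [set x; y] | x in T, y in T & e x y].

Definition cyclomatic_number (T : finType) (e : rel T) : int :=
  #|edges e|%:Z - #|T|%:Z + 1.

Definition bicyclic (T : finType) (e : rel T) : Prop :=
  [/\ simple_graph e, connected_graph e & cyclomatic_number e = 2].

Definition degree (T : finType) (e : rel T) (x : T) : nat :=
  #|[set y | e x y]|.

Definition max_degree (T : finType) (e : rel T) : nat :=
  (\max_(x : T) degree e x)%N.

Definition adjacency (T : finType) (e : rel T) : 'M[algC]_#|T| :=
  \matrix_(i, j) (e (enum_val i) (enum_val j))%:R.

(* The characteristic polynomial is monic, so the sequence s returned by
   [closed_field_poly_normal] satisfies
   char_poly A = \prod_(z <- s) ('X - z%:P):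
   it lists the eigenvalues of A with their algebraic multiplicities. *)
Definition eigenvalues (n : nat) (A : 'M[algC]_n) : seq algC :=
  sval (closed_field_poly_normal (char_poly A)).

Definition energy (T : finType) (e : rel T) : algC :=
  \sum_(z <- eigenvalues (adjacency e)) `|z|.

(* Main.v *)
Require Import Defs.
From mathcomp Require Import all_boot all_order all_algebra all_field.
From mathcomp Require Import ring lra zify.

Set Implicit Arguments.
Unset Strict Implicit.
Unset Printing Implicit Defensive.

Import Order.TTheory GRing.Theory Num.Theory.
Local Open Scope ring_scope.
Local Open Scope sesquilinear_scope.

(** Let [A] be the adjacency matrix and [B] a nonnegative symmetric matrix with
    row sums at most 4. The polynomial [p(x) = 3x/4 - x^3/16] maps [-4, 4] into
    [-1, 1], so [p(B)] is a contraction and trace duality gives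
    [E(G) >= tr (A p(B))]. Take for [B] the adjacency matrix with pendant edges
    reweighted by 13/10 and all other edges by 4/5. As the degrees of a bicyclic
    graph sum to [2n + 2], the trace equals [n + 16/25 - (4/125) Q + C], where
    [Q] is 8 times the number of 4-cycles and [C] is a sum of nonnegative local
    contributions of the vertices.

    The cycle space over F_2 has dimension 2, so there are at most three
    4-cycles. If there are at most two, then [E(G) > n]. If there are three, two
    of them share exactly two edges, which forces a K_{2,3} or a K_4; then
    a vertex next to a leaf contributes more than 16/125 to [C], so again
    [E(G) > n], and without leaves [G] is K_{2,3}, of odd order 5, whereas an
    integral energy is even. *)

(** * Lower bounds for the energy by trace duality *)

Lemma char_poly_conj {R : comUnitRingType} {n} (P A : 'M[R]_n) :
  P \in unitmx -> char_poly (invmx P *m A *m P) = char_poly A.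
Proof.
move=> uP; rewrite /char_poly /char_poly_mx !map_mxM /=.
set p := map_mx polyC P; set q := map_mx polyC (invmx P).
have qp : q *m p = 1%:M by rewrite -map_mxM mulVmx // map_mx1.
have -> : 'X%:M - q *m map_mx polyC A *m p = q *m ('X%:M - map_mx polyC A) *m p.
  by rewrite mulmxBr mulmxBl scalar_mxC -(mulmxA 'X%:M) qp mulmx1.
by rewrite !det_mulmx mulrAC -det_mulmx qp det1 mul1r.
Qed.

(** The matrix is similar to its spectral diagonal, so both have the same characteristic polynomial,
    and the linear factors of a split polynomial are unique up to order. *)
Lemma eigenvalues_spectral {n} (A : 'M[algC]_n) : A \is normalmx ->
  perm_eq (eigenvalues A) [seq spectral_diag A 0 i | i : 'I_n].
Proof.
move=> /orthomx_spectralP nA.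
rewrite /eigenvalues; case: closed_field_poly_normal => s /= Ds.
apply: prod_XsubC_eq => //.
move: Ds; rewrite (monicP (char_poly_monic A)) scale1r => <-.
rewrite {1}nA char_poly_conj ?spectral_unit // char_poly_trig ?diag_mx_is_trig //.
by rewrite big_map big_enum; apply: eq_bigr => i _; rewrite mxE eqxx.
Qed.

Lemma dotmx_ge0 {n} (v : 'rV[algC]_n) : 0 <= (v *m v^t*) 0 0.
Proof.
by rewrite mxE; apply: sumr_ge0 => i _; rewrite !mxE mul_conjC_ge0.
Qed.

(** In an orthonormal eigenbasis of [A], the trace is the sum of the eigenvalues times the diagonal
    entries of [S] in that basis. Such an entry is the form of [S] at a unit vector, so it has
    modulus at most 1. *)
Lemma trace_mul_le_energy {n} (A S : 'M[algC]_n) :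
  A \is hermsymmx ->
  (forall v : 'rV_n, `|(v *m S *m v^t*) 0 0| <= (v *m v^t*) 0 0) ->
  `|\tr (A *m S)| <= \sum_(z <- eigenvalues A) `|z|.
Proof.
move=> hA contr; have nA := hermitian_normalmx hA.
rewrite (perm_big _ (eigenvalues_spectral nA)) big_map big_enum /=.
have /unitarymxP uP := spectral_unitarymx A.
move/orthomx_spectralP: (nA) => Aeq; rewrite {1}Aeq mxtrace_mulC !mulmxA mxtrace_mulC !mulmxA.
rewrite invmx_unitary ?spectral_unitarymx //.
set P := spectralmx A in uP *; set D := spectral_diag A.
have -> : P *m S *m P^t* *m diag_mx D = \matrix_(i, j) ((P *m S *m P^t*) i j * D 0 j).
  by rewrite mul_mx_diag.
rewrite /mxtrace; apply: le_trans (ler_norm_sum _ _ _) _.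
apply: ler_sum => i _; rewrite mxE normrM ler_piMl //.
have -> : (P *m S *m P^t*) i i = (row i P *m S *m (row i P)^t*) 0 0.
  rewrite -row_mul !mxE; apply: eq_bigr => j _; by rewrite !mxE.
apply: le_trans (contr _) _.
have -> : (row i P *m (row i P)^t*) 0 0 = (P *m P^t*) i i.
  by rewrite !mxE; apply: eq_bigr => j _; rewrite !mxE.
by rewrite uP mxE eqxx.
Qed.

(** The hypotheses on [s] mean that it is 1 or -1. Twice the form is the sum of the [B i j] times
    |v_i + s v_j|^2, plus twice the sum of the slacks [c - \sum_j B i j] times |v_i|^2. *)
Lemma diag_dominant_form_ge0 {n} (B : 'M[algC]_n) (c : algC) (v : 'rV_n) (s : algC) :
    B^T = B -> (forall i j, 0 <= B i j) -> (forall i, \sum_j B i j <= c) ->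
    s * s^* = 1 -> s^* = s ->
  0 <= c * (v *m v^t*) 0 0 + s * (v *m B *m v^t*) 0 0.
Proof.
move=> symB B0 Bc s1 sr.
have vv : (v *m v^t*) 0 0 = \sum_i v 0 i * (v 0 i)^*.
  by rewrite mxE; apply: eq_bigr => i _; rewrite !mxE.
have vBv : (v *m B *m v^t*) 0 0 = \sum_i \sum_j B i j * (v 0 i * (v 0 j)^*).
  rewrite exchange_big mxE; apply: eq_bigr => j _; rewrite !mxE mulr_suml.
  by apply: eq_bigr => i _; rewrite mulrAC mulrC.
rewrite -(pmulr_rge0 _ (@ltr0n _ 2)).
have -> : 2 * (c * (v *m v^t*) 0 0 + s * (v *m B *m v^t*) 0 0) =
  \sum_i \sum_j B i j * ((v 0 i + s * v 0 j) * (v 0 i + s * v 0 j)^*) +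
  2 * \sum_i (c - \sum_j B i j) * (v 0 i * (v 0 i)^*).
  have -> : \sum_i \sum_j B i j * ((v 0 i + s * v 0 j) * (v 0 i + s * v 0 j)^*) =
     \sum_i (\sum_j B i j) * (v 0 i * (v 0 i)^*) +
     (\sum_i (\sum_j B i j) * (v 0 i * (v 0 i)^*) +
      (s * (v *m B *m v^t*) 0 0 + s * (v *m B *m v^t*) 0 0)).
    have e1 : \sum_i (\sum_j B i j) * (v 0 i * (v 0 i)^*) =
              \sum_i \sum_j B i j * (v 0 i * (v 0 i)^*).
      by apply: eq_bigr => i _; rewrite mulr_suml.
    have e2 : \sum_i (\sum_j B i j) * (v 0 i * (v 0 i)^*) =
              \sum_i \sum_j B i j * (v 0 j * (v 0 j)^*).
      rewrite exchange_big e1; apply: eq_bigr => i _; apply: eq_bigr => j _.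
      by rewrite -{1}symB mxE.
    have e3 : (v *m B *m v^t*) 0 0 = \sum_i \sum_j B i j * (v 0 j * (v 0 i)^*).
      rewrite vBv exchange_big; apply: eq_bigr => i _; apply: eq_bigr => j _.
      by rewrite -{1}symB mxE.
    rewrite {1}e1 e2 {1}vBv e3 !mulr_sumr -!big_split; apply: eq_bigr => i _ /=.
    rewrite !mulr_sumr -!big_split; apply: eq_bigr => j _ /=.
    rewrite rmorphD rmorphM /= sr.
    move: s1; rewrite sr => s1.
    have -> : v 0 j * (v 0 j)^* = s * s * (v 0 j * (v 0 j)^*) by rewrite s1 mul1r.
    ring.
  have -> : \sum_i (c - \sum_j B i j) * (v 0 i * (v 0 i)^*) =
     c * (v *m v^t*) 0 0 - \sum_i (\sum_j B i j) * (v 0 i * (v 0 i)^*).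
    by rewrite vv mulr_sumr -sumrB; apply: eq_bigr => i _; rewrite mulrBl.
  ring.
apply: addr_ge0; last apply: mulr_ge0 => //; apply: sumr_ge0 => i _.
  by apply: sumr_ge0 => j _; rewrite mulr_ge0 // mul_conjC_ge0.
by rewrite mulr_ge0 ?mul_conjC_ge0 // subr_ge0.
Qed.

(* [1 - p(x) = (x - 2)^2 (x + 4) / 16] and [1 + p(x) = (x + 2)^2 (4 - x) / 16]
   for [p(x) = 3x/4 - x^3/16], so [p] maps [-4, 4] into [-1, 1]. *)
Lemma cubic_contraction {n} (B : 'M[algC]_n) (v : 'rV_n) :
    B^T = B -> (forall i j, 0 <= B i j) -> (forall i, \sum_j B i j <= 4) ->
  `|(v *m (3/4 *: B - 1/16 *: (B *m B *m B)) *m v^t*) 0 0| <= (v *m v^t*) 0 0.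
Proof.
move=> symB B0 B4.
have conjB : B^t* = B.
  by apply/matrixP=> i j; rewrite symB mxE; apply/CrealP/ger0_real.
set x := ((v *m v^t*) 0 0); set S := _ - _.
have key (s : algC) : s * s = 1 -> s^* = s ->
    0 <= x - s * (v *m S *m v^t*) 0 0.
  (* Both factorizations at once: 16 (1 - s p(B)) = (B - 2s) (4 + s B) (B - 2s) when s^2 = 1, and 4
     + s B is positive semidefinite by diagonal dominance. *)
  move=> s1 sr; pose w := v *m (B - (2 * s)%:M).
  have := @diag_dominant_form_ge0 _ B 4 w s symB B0 B4; rewrite sr => /(_ s1 erefl).
  have wE : w^t* = (B - (2 * s)%:M) *m v^t*.
    rewrite /w trmx_mul map_mxM /= linearB /= tr_scalar_mx map_mxB /= conjB.
    by rewrite map_scalar_mx /= rmorphM /= sr rmorph_nat.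
  have -> : 4 * (w *m w^t*) 0 0 + s * (w *m B *m w^t*) 0 0 =
            16 * (x - s * (v *m S *m v^t*) 0 0).
    rewrite wE /w /x /S.
    set u := v^t*.
    rewrite !(mulmxBr, mulmxBl, mul_mx_scalar, mul_scalar_mx, mulmxA).
    rewrite -!(scalemxAl, scalemxAr) ?mulmxA.
    move: (v *m u) (v *m B *m u) (v *m B *m B *m u) (v *m B *m B *m B *m u).
    by move=> a0 a1 a2 a3; rewrite !mxE; field: s1.
  by rewrite pmulr_rge0 ?ltr0n.
have x_real : x \is Num.real by rewrite ger0_real ?dotmx_ge0.
have h1 := key 1 (mulr1 _) (rmorph1 _).
have h2 := key (-1) (ltac:(by rewrite mulrNN mulr1)) (ltac:(by rewrite rmorphN rmorph1)).
rewrite mul1r subr_ge0 in h1; rewrite mulN1r opprK -[X in 0 <= _ + X]opprK subr_ge0 in h2.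
rewrite real_ler_norml; first by rewrite h1 lerNl h2.
by rewrite (ler_real h1).
Qed.

Lemma adjacency_hermitian (T : finType) (e : rel T) :
  symmetric e -> adjacency e \is hermsymmx.
Proof.
move=> se; apply: realsym_hermsym.
  by apply/is_hermitianmxP/matrixP=> i j; rewrite expr0 scale1r !mxE se.
by apply/mxOverP=> i j; rewrite mxE realn.
Qed.

Lemma eigenvalue_Aint (T : finType) (e : rel T) z :
  z \in eigenvalues (adjacency e) -> z \in Aint.
Proof.
rewrite /eigenvalues; case: closed_field_poly_normal => s /=.
rewrite (monicP (char_poly_monic _)) scale1r => Ds zs.
apply: (@root_monic_Aint (char_poly (adjacency e))); last 1 first.
- have -> : adjacency e = map_mx intr (\matrix_(i, j) (e (enum_val i) (enum_val j))%:R).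
    by apply/matrixP=> i j; rewrite !mxE rmorph_nat.
  by rewrite -map_char_poly; apply/polyOverP => i; rewrite coef_map /= intr_int.
- by rewrite Ds root_prod_XsubC.
- exact: char_poly_monic.
Qed.

(* The adjacency matrix has trace zero, so half the energy is the sum of the
   nonnegative eigenvalues, an algebraic integer. *)
Lemma energy_even (T : finType) (e : rel T) k :
  simple_graph e -> energy e = k%:R -> ~~ odd k.
Proof.
case=> se ie Ek; set s := eigenvalues (adjacency e).
have hA := adjacency_hermitian se.
have nA := hermitian_normalmx hA.
have ps : perm_eq s _ := eigenvalues_spectral nA.
have real_s z : z \in s -> z \is Num.real.
  rewrite (perm_mem ps) => /mapP[i _ ->].
  by have /mxOverP := hermitian_spectral_diag_real hA; apply.
have sum_s : \sum_(z <- s) z = 0.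
  rewrite (perm_big _ ps) big_map big_enum /=.
  have tr0 : \tr (adjacency e) = 0.
    by rewrite /mxtrace big1 // => i _; rewrite mxE ie.
  move/orthomx_spectralP: (nA) => Aeq; rewrite -[RHS]tr0 [in RHS]Aeq.
  by rewrite mxtrace_mulC mulmxA mulmxV ?spectral_unit // mul1mx mxtrace_diag; apply: eq_bigl.
pose h : algC := \sum_(z <- s | 0 <= z) z.
have hE : k%:R = 2 * h.
  rewrite -Ek /energy -/s.
  have -> : \sum_(z <- s) `|z| = \sum_(z <- s) `|z| + \sum_(z <- s) z.
    by rewrite sum_s addr0.
  rewrite -big_split /= /h mulr_sumr.
  rewrite [RHS]big_mkcond; apply: eq_big_seq => z /real_s; rewrite realE.
  have [z0 _|_ /=] := boolP (0 <= z); first by rewrite ger0_norm // mulr_natl mulr2n.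
  by move=> z0; rewrite ler0_norm // addNr.
(* Being [k / 2], [h] is rational, and a rational algebraic integer is an integer. *)
have h_int : h \in Num.int.
  apply: Cint_rat_Aint.
    have -> : h = k%:R / 2 by rewrite hE mulrC mulKf // pnatr_eq0.
    by rewrite rpred_div // rpred_nat.
  rewrite /h big_seq_cond; apply: rpred_sum => z /andP[zs _]; exact: eigenvalue_Aint zs.
case/intrP: h_int => m hm; move: hE; rewrite hm.
rewrite -[2]/(2%:~R) -intrM -[k%:R]/(k%:Z%:~R) => /intr_inj km.
have : (2 %| k)%N by rewrite -[k]/(`|k%:Z|%N) km abszM dvdn_mulr.
by rewrite dvdn2.
Qed.

Definition rel_mx (T : finType) (f : T -> T -> rat) : 'M[rat]_#|T| :=
  \matrix_(i, j) f (enum_val i) (enum_val j).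

Lemma sum_enum_val (R : nmodType) (T : finType) (F : T -> R) :
  \sum_(i < #|T|) F (enum_val i) = \sum_x F x.
Proof. by rewrite [RHS](reindex (@enum_val T T)) //; apply/onW_bij/enum_val_bij. Qed.

Lemma rel_mx_mul (T : finType) (f g : T -> T -> rat) :
  rel_mx f *m rel_mx g = rel_mx (fun x y => \sum_z f x z * g z y).
Proof.
apply/matrixP=> i j; rewrite !mxE.
rewrite -[RHS](sum_enum_val (fun z => f _ z * g z _)).
by apply: eq_bigr => k _; rewrite !mxE.
Qed.

Lemma rel_mx_trace (T : finType) (f : T -> T -> rat) :
  \tr (rel_mx f) = \sum_x f x x.
Proof.
by rewrite -[RHS](sum_enum_val (fun x => f x x)); apply: eq_bigr => i _; rewrite mxE.
Qed.

(** The left side is tr (A p(B)) for the matrix B of [w]. The term tr (A B^3) is grouped as tr ((A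
    B) (B B)), so that it runs over the opposite corners [x], [y] of closed walks of length 4.
    Weights are rational, so the estimates take place in [rat] and only the result is sent to
    [algC]. *)
Lemma energy_ge_trace (T : finType) (e : rel T) (w : T -> T -> rat) :
    symmetric e -> (forall x y, w x y = w y x) -> (forall x y, 0 <= w x y) ->
    (forall x, \sum_y w x y <= 4) ->
  ratr (3/4 * (\sum_x \sum_y (e x y)%:R * w y x) -
        1/16 * (\sum_x \sum_y (\sum_z (e x z)%:R * w z y) * (\sum_z w y z * w z x)))
    <= energy e :> algC.
Proof.
move=> se sw w0 w4; pose B := map_mx (ratr : rat -> algC) (rel_mx w).
pose A := rel_mx (fun x y => (e x y)%:R).
have AE : adjacency e = map_mx ratr A.
  by apply/matrixP=> i j; rewrite !mxE rmorph_nat.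
have := @trace_mul_le_energy _ (adjacency e) (3/4 *: B - 1/16 *: (B *m B *m B))
  (adjacency_hermitian se) (fun v => cubic_contraction v _ _ _).
rewrite -/(energy e) => /(_ _ _ _) trE.
have {}trE : `|\tr (adjacency e *m ((3/4) *: B - (1/16) *: (B *m B *m B)))| <= energy e.
  apply: trE => [|i j|i].
  - by apply/matrixP=> i j; rewrite !mxE sw.
  - by rewrite !mxE ler0q.
  - under eq_bigr do rewrite !mxE.
    rewrite -rmorph_sum /= -(ratr_nat _ 4) ler_rat.
    by rewrite (sum_enum_val (fun y => w (enum_val i) y)).
have -> : 3/4 * (\sum_x \sum_y (e x y)%:R * w y x) -
    1/16 * (\sum_x \sum_y (\sum_z (e x z)%:R * w z y) * (\sum_z w y z * w z x)) =
    \tr (A *m (3/4 *: rel_mx w - 1/16 *: (rel_mx w *m rel_mx w *m rel_mx w))).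
  rewrite mulmxBr !linearB /= -!scalemxAr !linearZ /= -(mulmxA (rel_mx w)) (mulmxA A).
  by rewrite !rel_mx_mul !rel_mx_trace.
set S := _ - _ in trE *; set R := _ - _.
have RS : ratr (\tr (A *m R)) = \tr (adjacency e *m S).
  rewrite -(trace_map_mx _ (A *m R)) map_mxM -AE map_mxB !map_mxZ !map_mxM.
  by rewrite !rmorphM !fmorphV !rmorph_nat rmorph1.
apply: le_trans trE; rewrite -RS; apply: real_ler_norm.
by rewrite Creal_Crat // Crat_rat.
Qed.

(** * The weighted adjacency matrix *)

Definition leaf (T : finType) (e : rel T) (x : T) : bool := degree e x == 1%N.

Definition leaf_degree (T : finType) (e : rel T) (x : T) : nat :=
  #|[set y | e x y && leaf e y]|.

Definition inner_degree (T : finType) (e : rel T) (x : T) : nat :=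
  #|[set y | e x y && ~~ leaf e y]|.

(* Pendant edges are made heavier: (A^3)_uv is about 3 on a pendant edge but 5 on
   an edge between vertices of degree 3, so this moves [p(B)] closer to sign(A). *)
Definition weight (T : finType) (e : rel T) (x y : T) : rat :=
  if e x y then (if leaf e x || leaf e y then 13/10 else 4/5) else 0.

Definition strength (T : finType) (e : rel T) (r : nat) (x : T) : rat :=
  \sum_y weight e x y ^+ r.

(* The 4-cycle x z y t: [x], [y] and [z], [t] are the opposite pairs. A 4-cycle of
   the graph gives rise to 8 such quadruples. *)
Definition square4 (T : finType) (e : rel T) (x y z t : T) : bool :=
  [&& x != y, z != t, e x z, e z y, e y t & e t x].

Definition squares (T : finType) (e : rel T) : {set T * T * (T * T)} :=
  [set p | square4 e p.1.1 p.1.2 p.2.1 p.2.2].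

Lemma degree_split (T : finType) (e : rel T) x :
  degree e x = (leaf_degree e x + inner_degree e x)%N.
Proof.
rewrite /degree -(cardsID [set y | leaf e y]); congr (_ + _)%N; apply: eq_card => y;
by rewrite !inE // andbC.
Qed.

Lemma sum_constE (T : finType) (P : pred T) (c : rat) :
  \sum_(y | P y) c = #|[set y | P y]|%:R * c.
Proof.
by rewrite -sum1dep_card natr_sum mulr_suml; apply: eq_bigr => y _; rewrite mul1r.
Qed.

Lemma strengthE (T : finType) (e : rel T) r x : (0 < r)%N ->
  strength e r x =
  if leaf e x then (degree e x)%:R * (13/10) ^+ r
  else (leaf_degree e x)%:R * (13/10) ^+ r + (inner_degree e x)%:R * (4/5) ^+ r.
Proof.
move=> r0; have z0 : 0 ^+ r = 0 :> rat by rewrite expr0n eqn0Ngt r0.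
have -> : strength e r x =
   \sum_(y | e x y) (if leaf e x || leaf e y then 13/10 else 4/5) ^+ r.
  rewrite /strength [RHS]big_mkcond; apply: eq_bigr => y _.
  by rewrite /weight; case: (e x y).
have [lx|nlx] := boolP (leaf e x); first by rewrite /= sum_constE.
rewrite (bigID (leaf e)) /=; congr (_ + _); rewrite -sum_constE; apply: eq_bigr => y.
  by case/andP=> _ ->.
by case/andP=> _ /negPf ->.
Qed.

Lemma weight_sym (T : finType) (e : rel T) x y :
  symmetric e -> weight e x y = weight e y x.
Proof. by move=> se; rewrite /weight se orbC. Qed.

Lemma weight_ge0 (T : finType) (e : rel T) x y : 0 <= weight e x y.
Proof.
rewrite /weight; case: (e x y); last exact: lexx.
by case: (_ || _); rewrite divr_ge0 ?ler0n.
Qed.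

Lemma adj_weight (T : finType) (e : rel T) x y :
  (e x y)%:R * weight e x y = weight e x y.
Proof. by rewrite /weight; case: (e x y); rewrite ?mul1r ?mul0r. Qed.

(** The extreme case is three pendant edges, of total weight 39/10, which still fits into the
    interval [-4, 4] where p is bounded by 1. *)
Lemma weight_row_le (T : finType) (e : rel T) x :
  (degree e x <= 3)%N -> \sum_y weight e x y <= 4.
Proof.
move=> d3; have -> : \sum_y weight e x y = strength e 1 x by [].
rewrite strengthE //; move: d3; rewrite degree_split => d3.
have : (leaf_degree e x)%:R + (inner_degree e x)%:R <= 3 :> rat.
  by rewrite -natrD (ler_nat _ _ 3).
have : 0 <= (inner_degree e x)%:R :> rat by rewrite ler0n.
have : 0 <= (leaf_degree e x)%:R :> rat by rewrite ler0n.
by case: ifP => _; rewrite ?natrD !expr1; lra.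
Qed.

(** Every vertex of a 4-cycle has two neighbors on it. Hence no edge of a 4-cycle is pendant, and
    all of them have weight 4/5. *)
Lemma square4_inner (T : finType) (e : rel T) x y z t : symmetric e ->
  square4 e x y z t -> ~~ leaf e x /\ ~~ leaf e z.
Proof.
move=> se /and5P[xy zt xz zy /andP[yt tx]].
split; rewrite /leaf neq_ltn; apply/orP; right.
  have <- : #|[set z; t]| = 2%N by rewrite cards2 zt.
  by apply: subset_leq_card; apply/subsetP => a; rewrite !inE => /orP[]/eqP-> //; rewrite se.
have <- : #|[set x; y]| = 2%N by rewrite cards2 xy.
by apply: subset_leq_card; apply/subsetP => a; rewrite !inE => /orP[]/eqP-> //; rewrite se.
Qed.

(** A closed walk x z y t either has x = y, or z = t, or is a 4-cycle. Each of the two degenerate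
    kinds contributes the products of the first and second strengths at the repeated vertex; walks
    of both kinds are counted twice, which the third strengths correct. A 4-cycle carries three
    weighted steps 4/5, the remaining step coming from A with entry 1. *)
Lemma quartic_weight (T : finType) (e : rel T) : symmetric e ->
  \sum_x \sum_y (\sum_z (e x z)%:R * weight e z y) * (\sum_z weight e y z * weight e z x)
  = \sum_x (2 * strength e 1 x * strength e 2 x - strength e 3 x)
    + (4/5) ^+ 3 * #|squares e|%:R.
Proof.
move=> se; pose w := weight e.
have sw x y : w x y = w y x by exact: weight_sym.
have diag x : (\sum_z (e x z)%:R * w z x) * (\sum_z w x z * w z x) =
              strength e 1 x * strength e 2 x.
  congr (_ * _); apply: eq_bigr => z _; first by rewrite sw adj_weight.
  by rewrite (sw z).
have off x y : x != y ->
    (\sum_z (e x z)%:R * w z y) * (\sum_z w y z * w z x) =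
    \sum_z w z x * w z y ^+ 2 +
    \sum_z \sum_t (4/5) ^+ 3 * (square4 e x y z t)%:R.
  move=> xy; rewrite mulr_suml -big_split; apply: eq_bigr => z _ /=.
  (* The term t = z is the degenerate walk; for t different from z the product vanishes unless all
     four edges are present. *)
  rewrite mulr_sumr (bigD1 z) //= [in RHS](bigD1 z) //=.
  have -> : square4 e x y z z = false by rewrite /square4 eqxx andbF.
  rewrite mulr0 add0r; congr (_ + _).
    have aw : (e x z)%:R * w z x = w z x by rewrite sw adj_weight.
    by rewrite (sw y z) -[in RHS]aw; ring.
  apply: eq_bigr => t tz; have [sq|] := boolP (square4 e x y z t).
    have [nx nz] := square4_inner se sq.
    have [ny nt] : ~~ leaf e y /\ ~~ leaf e t.
      by apply: (square4_inner (y := x) (z := t) (t := z) se); move: sq;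
         rewrite /square4 (eq_sym y x) (eq_sym t z) (se y t) (se t x) (se x z) (se z y);
         case/and5P=> -> -> -> -> /andP[-> ->].
    move: sq => /and5P[_ _ xz zy /andP[yt tx]].
    rewrite /w /weight xz zy yt tx (negPf nx) (negPf ny) (negPf nz) (negPf nt) /=.
    by field.
  rewrite /square4 xy eq_sym tz /= /w /weight => nsq; rewrite mulr0.
  by move: nsq; do 4?[case: (e _ _) => /=] => //; rewrite ?mul0r ?mulr0.
have card_sq : #|squares e|%:R = \sum_x \sum_y \sum_z \sum_t (square4 e x y z t)%:R :> rat.
  rewrite -sum1_card natr_sum pair_bigA big_mkcond /=.
  rewrite (eq_bigr (fun p => \sum_q (square4 e p.1 p.2 q.1 q.2)%:R)) => [|p _]; last first.
    by rewrite pair_bigA.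
  by rewrite pair_bigA; apply: eq_bigr => p _; rewrite inE; case: ifP.
have -> : \sum_x (2 * strength e 1 x * strength e 2 x - strength e 3 x) =
    \sum_x strength e 1 x * strength e 2 x +
    \sum_x \sum_(y | y != x) \sum_z w z x * w z y ^+ 2.
  have -> : \sum_x \sum_(y | y != x) \sum_z w z x * w z y ^+ 2 =
            \sum_z (strength e 1 z * strength e 2 z - strength e 3 z).
    under eq_bigr do rewrite exchange_big /=.
    rewrite exchange_big; apply: eq_bigr => z _ /=.
    rewrite /strength mulr_suml -sumrB; apply: eq_bigr => x _.
    by rewrite mulr_sumr [in RHS](bigD1 x) //= -exprD [RHS]addrC addKr.
  by rewrite -big_split; apply: eq_bigr => x _ /=; ring.
rewrite card_sq mulr_sumr -!big_split; apply: eq_bigr => x _ /=.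
rewrite (bigD1 x) //= diag -addrA; congr (_ + _).
have sq0 : \sum_z \sum_t (square4 e x x z t)%:R = 0 :> rat.
  by rewrite big1 // => z _; rewrite big1 // => t _; rewrite /square4 eqxx.
rewrite mulr_sumr [X in _ + X](bigD1 x) //= sq0 mulr0 add0r.
rewrite -big_split; apply: eq_bigr => y yx /=; rewrite off 1?eq_sym //; congr (_ + _).
by rewrite mulr_sumr; apply: eq_bigr => z _; rewrite mulr_sumr.
Qed.

(* The coefficient 8/25 is the multiplier of the constraint that the [degree - 2]
   sum to 2, chosen so that a vertex of degree 3 without leaves has charge 0; with
   31/200 every leaf passes a share of its own contribution to its neighbor. *)
Definition charge (T : finType) (e : rel T) (x : T) : rat :=
  3/4 * strength e 1 x
  - 1/16 * (2 * strength e 1 x * strength e 2 x - strength e 3 x)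
  - 1 - 8/25 * ((degree e x)%:R - 2)
  + 31/200 * ((leaf_degree e x)%:R - (leaf e x)%:R * (degree e x)%:R).

(** With [k] leaf neighbors and [m] other neighbors only finitely many cases remain, each a
    numerical inequality. The bound 16/125 is the deficit 24 * 4/125 - 16/25 caused by three
    4-cycles. It fails for [k = 3], where the value is only about 1/100. *)
Lemma charge_numeric (R : realFieldType) (k m : nat) (lf : bool) (s : nat -> R) :
    (0 < k + m <= 3)%N -> lf = (k + m == 1)%N ->
    (forall r, (0 < r)%N -> s r =
      if lf then (k + m)%:R * (13/10) ^+ r
      else k%:R * (13/10) ^+ r + m%:R * (4/5) ^+ r) ->
  let X := 3/4 * s 1%N - 1/16 * (2 * s 1%N * s 2%N - s 3%N)
           - 1 - 8/25 * ((k + m)%:R - 2) + 31/200 * (k%:R - lf%:R * (k + m)%:R) in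
  0 <= X /\ ((0 < k < 3)%N -> 16/125 < X).
Proof.
move=> km -> sE /=; rewrite !sE //; move: km; clear.
case: k => [|[|[|[|k]]]]; case: m => [|[|[|[|m]]]] //=; rewrite ?addnS //= => _.
all: split; first by lra.
all: try by [].
all: by move=> _; lra.
Qed.

Lemma charge_bounds (T : finType) (e : rel T) x : (0 < degree e x <= 3)%N ->
  0 <= charge e x /\ ((0 < leaf_degree e x < 3)%N -> 16/125 < charge e x).
Proof.
rewrite /charge degree_split => dx.
apply: (@charge_numeric _ (leaf_degree e x) (inner_degree e x) _ (strength e ^~ x)).
- exact: dx.
- by rewrite /leaf degree_split.
by move=> r r0; rewrite strengthE // degree_split.
Qed.

(** Both sides count the pairs of a leaf and a neighbor of it. Hence the shares passed from leaves
    to neighbors in [charge] cancel in the total. *)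
Lemma sum_leaf_degree (T : finType) (e : rel T) : symmetric e ->
  (\sum_x leaf_degree e x = \sum_x leaf e x * degree e x)%N.
Proof.
move=> se; under eq_bigr do rewrite /leaf_degree -sum1dep_card big_mkcond /=.
rewrite exchange_big; apply: eq_bigr => y _ /=.
rewrite /degree -sum1dep_card big_distrr /= [RHS]big_mkcond; apply: eq_bigr => x _.
by rewrite se; case: (e y x); case: (leaf e y).
Qed.

Lemma sum_lin_comb (T : finType) (R : comNzRingType) (a b c d : R) (F G H K : T -> R) :
  \sum_x (a * F x - b * G x - 1 - c * H x + d * K x) =
  a * \sum_x F x - b * \sum_x G x - \sum_(x : T) 1 - c * \sum_x H x + d * \sum_x K x.
Proof. by rewrite big_split !sumrB -!mulr_sumr. Qed.

(** The constant 16/25 is the multiplier 8/25 times the total 2 of the [degree - 2], and 4/125 is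
    (4/5)^3 / 16, the cost of one labelled 4-cycle in tr (A p(B)). *)
Lemma energy_ge_charge (T : finType) (e : rel T) :
    symmetric e -> (forall x, degree e x <= 3)%N ->
    (\sum_x degree e x = (2 * #|T|).+2)%N ->
  ratr (#|T|%:R + 16/25 - 4/125 * #|squares e|%:R + \sum_x charge e x)
    <= energy e :> algC.
Proof.
move=> se d3 sumd; have := energy_ge_trace se (fun x y => weight_sym x y se)
  (weight_ge0 e) (fun x => weight_row_le (d3 x)).
rewrite (quartic_weight se); congr (ratr _ <= _).
have -> : \sum_x \sum_y (e x y)%:R * weight e y x = \sum_x strength e 1 x.
  by apply: eq_bigr => x _; apply: eq_bigr => y _; rewrite (weight_sym y) // adj_weight.
have sd : \sum_x (degree e x)%:R = 2 * #|T|%:R + 2 :> rat.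
  by rewrite -natr_sum sumd -addn2 natrD natrM.
have sk : \sum_x ((leaf_degree e x)%:R - (leaf e x)%:R * (degree e x)%:R) = 0 :> rat.
  rewrite sumrB; under [X in _ - X]eq_bigr do rewrite -natrM.
  by rewrite -!natr_sum (sum_leaf_degree se) subrr.
have sd2 : \sum_x ((degree e x)%:R - 2) = 2 * #|T|%:R + 2 - 2 * #|T|%:R :> rat.
  by rewrite sumrB sd sumr_const -[X in _ - X]mulr_natr.
have s1 : \sum_(x : T) 1 = #|T|%:R :> rat by rewrite sumr_const.
rewrite /charge sum_lin_comb sk sd2 s1.
by field.
Qed.

(** * Four-cycles and the cycle space *)

Lemma set2_eq (T : finType) (a b c d : T) :
  ([set a; b] == [set c; d]) = (a == c) && (b == d) || (a == d) && (b == c).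
Proof.
apply/eqP/idP => [ab|/orP[]/andP[/eqP-> /eqP->] //]; last exact: setUC.
have /setP ac := ab.
have := ac a; have := ac b; have := ac c; have := ac d.
rewrite !inE !eqxx !orbT /= (eq_sym d a) (eq_sym d b) (eq_sym c a) (eq_sym c b).
by do 4![case: (_ == _) => //=].
Qed.

Lemma edgeP (T : finType) (e : rel T) (E : {set T}) :
  reflect (exists a b, e a b /\ E = [set a; b]) (E \in edges e).
Proof.
apply: (iffP imset2P) => [[a b _]|[a [b [ab ->]]]].
  by rewrite inE => ab ->; exists a, b.
by exists a b; rewrite // inE.
Qed.

Lemma set2_in_edges (T : finType) (e : rel T) a b :
  symmetric e -> ([set a; b] \in edges e) = e a b.
Proof.
move=> se; apply/edgeP/idP => [[c [d [cd /eqP]]]|ab]; last by exists a, b.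
by rewrite set2_eq => /orP[]/andP[/eqP-> /eqP->] //; rewrite se.
Qed.

Lemma sum_degree (T : finType) (e : rel T) : simple_graph e ->
  (\sum_x degree e x = 2 * #|edges e|)%N.
Proof.
move=> [se ie]; pose arcs := [set p : T * T | e p.1 p.2].
have -> : (\sum_x degree e x = #|arcs|)%N.
  rewrite -sum1_card (eq_bigl (fun p : T * T => xpredT p.1 && e p.1 p.2)) => [|p].
    rewrite -(pair_big_dep xpredT (fun x y => e x y) (fun _ _ => 1%N)) /=.
    by apply: eq_bigr => x _; rewrite sum1dep_card.
  by rewrite inE.
pose f (p : T * T) := [set p.1; p.2].
rewrite -sum1_card (partition_big f (mem (edges e))) /= => [|p]; last first.
  by rewrite inE set2_in_edges.
rewrite -sum1_card big_distrr /=; apply: eq_bigr => E /edgeP[a [b [ab ->]]].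
rewrite sum1dep_card muln1.
have -> : [set p | (p \in arcs) && (f p == [set a; b])] = [set (a, b); (b, a)].
  apply/setP => -[x y]; rewrite !inE /f set2_eq !xpair_eqE /= andb_idl //.
  by case/orP=> /andP[/eqP-> /eqP->] //; rewrite se.
rewrite cards2 xpair_eqE; case: eqP => // abE.
by move: ab; rewrite abE ie.
Qed.

Lemma connected_closed (T : finType) (e : rel T) (S : {set T}) x :
    symmetric e -> connected_graph e -> x \in S ->
    (forall y z, y \in S -> e y z -> z \in S) ->
  S = [set: T].
Proof.
move=> se [_ con] xS cl; apply/setP => y; rewrite inE.
rewrite -(@closed_connect _ e (mem S) _ x y) // => a b ab.
by apply/idP/idP => [aS|bS]; [exact: cl ab | apply: (cl b) => //; rewrite se].
Qed.

Lemma F2_cases (x : 'F_2) : x = 0 \/ x = 1.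
Proof. by case: x => [[|[|//]] ?]; [left|right]; apply: val_inj. Qed.

(** Two distinct nonzero vectors over F_2 are independent, so they span the whole of [K], and their
    only nonzero combinations are the three listed. *)
Lemma F2_plane m (K : 'M['F_2]_m) (a b c : 'rV['F_2]_m) :
    (\rank K <= 2)%N -> (a <= K)%MS -> (b <= K)%MS -> (c <= K)%MS ->
    a != 0 -> b != 0 -> a != b -> c != 0 ->
  [\/ c = a, c = b | c = a + b].
Proof.
move=> K2 aK bK cK a0 b0 ab c0.
have comb (u : 'rV['F_2]_(1 + 1)) :
    u *m col_mx a b = u 0 (lshift 1 0) *: a + u 0 (rshift 1 0) *: b.
  rewrite -{1}[u]hsubmxK mul_row_col.
  by rewrite [lsubmx u]mx11_scalar [rsubmx u]mx11_scalar !mul_scalar_mx !mxE.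
have abF : a + b != 0.
  apply: contra ab => /eqP ab0; rewrite -subr_eq0.
  suff -> : - b = b by apply/eqP.
  by apply/rowP=> i; rewrite mxE; case: (F2_cases (b 0 i)) => ->; apply/val_inj.
have free : row_free (col_mx a b).
  rewrite -kermx_eq0; apply/eqP/row_matrixP => i; rewrite row0.
  have : row i (kermx (col_mx a b)) *m col_mx a b = 0 by apply/sub_kermxP/row_sub.
  set u := row i _; rewrite comb.
  case: (F2_cases (u 0 (lshift 1 0))) => ul; case: (F2_cases (u 0 (rshift 1 0))) => ur;
    rewrite ul ur ?scale0r ?scale1r ?add0r ?addr0 => /eqP.
  - move=> _; rewrite -[u]hsubmxK; apply/rowP=> j; rewrite !mxE.
    by case: splitP => k _; rewrite !ord1 mxE.
  - by rewrite (negPf b0).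
  - by rewrite (negPf a0).
  - by rewrite (negPf abF).
have sub : (col_mx a b <= K)%MS by rewrite col_mx_sub aK bK.
have KV : (K <= col_mx a b)%MS.
  have [rk <-] := mxrank_leqif_sup sub.
  by rewrite eqn_leq rk /= (eqP free).
have /submxP[u cE] := submx_trans cK KV; move: c0; rewrite cE comb.
case: (F2_cases (u 0 (lshift 1 0))) => ->; case: (F2_cases (u 0 (rshift 1 0))) => ->;
  rewrite ?scale0r ?scale1r ?add0r ?addr0 => c0.
- by rewrite eqxx in c0.
- exact: Or32.
- exact: Or31.
- exact: Or33.
Qed.

(** Rows are edges, so the left kernel [kermx] consists of the edge sets meeting every vertex an
    even number of times: the cycle space. *)
Definition incidence (T : finType) (e : rel T) : 'M['F_2]_(#|edges e|, #|T|) :=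
  \matrix_(i, j) ((enum_val j : T) \in (enum_val i : {set T}))%:R.

Lemma rank_cycle_space (T : finType) (e : rel T) :
  symmetric e -> connected_graph e ->
  (\rank (kermx (incidence e)) <= (#|edges e|).+1 - #|T|)%N.
Proof.
move=> se ce; have [T0 _] := ce; set M := incidence e.
(* A vector in the kernel of the transpose is a function on vertices whose values at the ends of
   each edge sum to 0, that is, agree over F_2. By connectedness it is constant, so the incidence
   matrix has rank at least [#|T| - 1]. *)
suff : (\rank (kermx M^T) <= 1)%N.
  rewrite !mxrank_ker mxrank_tr.
  have := rank_leq_row M; have := rank_leq_col M.
  lia.
apply: leq_trans (rank_leq_row (const_mx 1 : 'rV['F_2]_#|T|)).
apply/mxrankS/row_subP => i.
have := sub_kermxP (row_sub i (kermx M^T)); move: (row i _) => v vM.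
have [x0 _] : exists x0 : T, true by case/card_gt0P: T0 => x _; exists x.
pose g x := v 0 (enum_rank x).
have gE x y : e x y -> x != y -> g x = g y.
  move=> xy nxy; have nyx : y != x by rewrite eq_sym.
  have E : [set x; y] \in edges e by rewrite set2_in_edges.
  have /rowP/(_ (enum_rank_in E [set x; y])) := vM; rewrite !mxE.
  under eq_bigr do rewrite !mxE enum_rankK_in //.
  rewrite (reindex (@enum_rank T)) /=; last exact/onW_bij/enum_rank_bij.
  under eq_bigr do rewrite enum_rankK !inE -/(g _).
  rewrite (bigD1 x) //= (bigD1 y) //= big1 => [|z /andP[/negPf-> /negPf->]].
    rewrite !eqxx orbT !mulr1 addr0.
    by case: (F2_cases (g x)) => ->; case: (F2_cases (g y)) => ->.
  by rewrite mulr0.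
have gc : [set x | g x == g x0] = [set: T].
  apply: (connected_closed (x := x0) se ce); first by rewrite inE.
  move=> y z; rewrite !inE => /eqP <- yz; have [->//|nyz] := eqVneq y z.
  by rewrite (gE y z).
apply/submxP; exists (g x0)%:M; apply/rowP => j; rewrite mul_scalar_mx !mxE mulr1.
have : enum_val j \in [set x | g x == g x0] by rewrite gc inE.
by rewrite inE /g enum_valK => /eqP <-.
Qed.

Definition cycle_edges (T : finType) (x y z t : T) : {set {set T}} :=
  [set E in [:: [set x; z]; [set z; y]; [set y; t]; [set t; x]]].

Lemma square4_neq (T : finType) (e : rel T) x y z t : irreflexive e ->
  square4 e x y z t -> [/\ [&& x != y, z != t & x != z], z != y, y != t & t != x].
Proof.
move=> ie /and5P[-> -> xz zy /andP[yt tx]].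
have ne a b : e a b -> a != b by case: eqP => // ->; rewrite ie.
by rewrite !ne.
Qed.

Lemma neqF (T : eqType) (a b : T) : a != b -> ((a == b) = false) * ((b == a) = false).
Proof. by move=> ab; rewrite (eq_sym b a) (negPf ab). Qed.

Lemma uniq_cycle_edges (T : finType) (e : rel T) x y z t : irreflexive e ->
  square4 e x y z t -> uniq [:: [set x; z]; [set z; y]; [set y; t]; [set t; x]].
Proof.
move=> ie /(square4_neq ie)[/and3P[xy zt xz] zy yt tx].
by rewrite /= !inE !set2_eq !(neqF xy, neqF zt, neqF xz, neqF zy, neqF yt, neqF tx) !andbF.
Qed.

Lemma card_cycle_edges (T : finType) (e : rel T) x y z t : irreflexive e ->
  square4 e x y z t -> #|cycle_edges x y z t| = 4%N.
Proof.
by move=> ie /(uniq_cycle_edges ie) u; rewrite cardsE (card_uniqP u).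
Qed.

Lemma cycle_edges_sub (T : finType) (e : rel T) x y z t : symmetric e ->
  square4 e x y z t -> cycle_edges x y z t \subset edges e.
Proof.
move=> se /and5P[_ _ xz zy /andP[yt tx]]; apply/subsetP => E.
by rewrite !inE => /or4P[] /eqP->; rewrite set2_in_edges.
Qed.

Definition edge_vector (T : finType) (e : rel T) (Z : {set {set T}}) : 'rV['F_2]_#|edges e| :=
  \row_i ((enum_val i : {set T}) \in Z)%:R.

Lemma F2_nat_inj (a b : bool) : a%:R = b%:R :> 'F_2 -> a = b.
Proof. by case: a; case: b. Qed.

Lemma edge_vectorE (T : finType) (e : rel T) (Z : {set {set T}}) E (hE : E \in edges e) :
  edge_vector e Z 0 (enum_rank_in hE E) = (E \in Z)%:R.
Proof. by rewrite mxE enum_rankK_in. Qed.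

Lemma edge_vector_inj (T : finType) (e : rel T) (Z W : {set {set T}}) :
  Z \subset edges e -> W \subset edges e -> edge_vector e Z = edge_vector e W -> Z = W.
Proof.
move=> sZ sW ZW; apply/setP => E; have [hE|nE] := boolP (E \in edges e).
  by apply: F2_nat_inj; rewrite -!(edge_vectorE _ hE) ZW.
by rewrite (contraNF (subsetP sZ E) nE) (contraNF (subsetP sW E) nE).
Qed.

(** Each vertex lies on two or none of the four edges, and 1 + 1 = 0 in F_2. *)
Lemma cycle_vector_ker (T : finType) (e : rel T) x y z t : simple_graph e ->
  square4 e x y z t -> (edge_vector e (cycle_edges x y z t) <= kermx (incidence e))%MS.
Proof.
move=> [se ie] sq; apply/sub_kermxP/rowP => j; rewrite !mxE.
under eq_bigr do rewrite !mxE.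
set v : T := enum_val j.
pose h (E : {set T}) : 'F_2 := (E \in cycle_edges x y z t)%:R * (v \in E)%:R.
have -> : \sum_(i < #|edges e|)
    ((enum_val i : {set T}) \in cycle_edges x y z t)%:R *
    (v \in (enum_val i : {set T}))%:R = \sum_(E in edges e) h E by rewrite [RHS]big_enum_val.
have -> : \sum_(E in edges e) h E =
    \sum_(E <- [:: [set x; z]; [set z; y]; [set y; t]; [set t; x]]) (v \in E)%:R.
  rewrite big_uniq ?(uniq_cycle_edges ie sq) //= (big_setID (cycle_edges x y z t)) /=.
  rewrite [X in _ + X]big1 ?addr0 => [|E]; last first.
    by rewrite !inE /h => /andP[/negPf]; rewrite !inE => -> _; rewrite mul0r.
  rewrite (setIidPr (cycle_edges_sub se sq)); apply: eq_big => E; first by rewrite !inE.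
  by rewrite /h => ->; rewrite mul1r.
have [/and3P[xy zt xz] zy yt tx] := square4_neq ie sq.
rewrite !big_cons big_nil !inE.
have neqE := (neqF xy, neqF zt, neqF xz, neqF zy, neqF yt, neqF tx).
have [->|_] := eqVneq v x; first by rewrite !neqE; apply/val_inj.
have [->|_] := eqVneq v z; first by rewrite !neqE; apply/val_inj.
have [->|_] := eqVneq v y; first by rewrite !neqE; apply/val_inj.
by have [_|_] := eqVneq v t; apply/val_inj.
Qed.

Lemma square4_swapl (T : finType) (e : rel T) x y z t :
  symmetric e -> square4 e x y z t -> square4 e y x z t.
Proof.
move=> se /and5P[xy zt xz zy /andP[yt tx]].
by rewrite /square4 (eq_sym y x) xy zt (se y z) zy (se z x) xz (se x t) tx (se t y) yt.
Qed.

Lemma square4_swap (T : finType) (e : rel T) x y z t :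
  symmetric e -> square4 e x y z t -> square4 e z t x y.
Proof.
move=> se /and5P[xy zt xz zy /andP[yt tx]].
by rewrite /square4 xy zt (se z x) xz (se x t) tx (se t y) yt (se y z) zy.
Qed.

Lemma square4_swapr (T : finType) (e : rel T) x y z t :
  symmetric e -> square4 e x y z t -> square4 e x y t z.
Proof.
by move=> se sq; exact: square4_swap se (square4_swapl se (square4_swap se sq)).
Qed.

Lemma cycle_edges_swapl (T : finType) (x y z t : T) :
  cycle_edges y x z t = cycle_edges x y z t.
Proof.
apply/setP => E; rewrite !inE (setUC [set y] [set z]) (setUC [set z] [set x])
  (setUC [set x] [set t]) (setUC [set t] [set y]).
by do 4!case: (E == _) => //=.
Qed.

Lemma cycle_edges_swap (T : finType) (x y z t : T) :
  cycle_edges z t x y = cycle_edges x y z t.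
Proof.
apply/setP => E; rewrite !inE (setUC [set z] [set x]) (setUC [set x] [set t])
  (setUC [set t] [set y]) (setUC [set y] [set z]).
by do 4!case: (E == _) => //=.
Qed.

Lemma cycle_edges_swapr (T : finType) (x y z t : T) :
  cycle_edges x y t z = cycle_edges x y z t.
Proof. by rewrite -cycle_edges_swap cycle_edges_swapl cycle_edges_swap. Qed.

Lemma in_cycle_edges (T : finType) (u w x y z t : T) :
  ([set u; w] \in cycle_edges x y z t) =
  ((u == x) || (u == y)) && ((w == z) || (w == t)) ||
  ((u == z) || (u == t)) && ((w == x) || (w == y)).
Proof.
rewrite !inE !set2_eq.
by do 4!case: (u == _) => //=; do 4!case: (w == _) => //=.
Qed.

(** The symmetries of the square act transitively on oriented edges, so a 4-cycle can be relabelled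
    to start with any chosen one. *)
Lemma square4_through (T : finType) (e : rel T) x y z t a b : symmetric e ->
    square4 e x y z t -> [set a; b] \in cycle_edges x y z t ->
  exists y' t', square4 e a y' b t' /\ cycle_edges a y' b t' = cycle_edges x y z t.
Proof.
move=> se sq; rewrite in_cycle_edges.
have sql := square4_swapl se sq; have sqr := square4_swapr se sq.
have sqlr := square4_swapr se sql.
have S := square4_swap se.
case/orP=> /andP[/orP[]/eqP-> /orP[]/eqP->].
- by exists y, t.
- by exists y, z; rewrite cycle_edges_swapr.
- by exists x, t; rewrite cycle_edges_swapl.
- by exists x, z; rewrite cycle_edges_swapr cycle_edges_swapl.
- by exists t, y; rewrite cycle_edges_swap; split; first exact: S.
- by exists t, x; rewrite cycle_edges_swap cycle_edges_swapl; split; first exact: S.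
- by exists z, y; rewrite cycle_edges_swap cycle_edges_swapr; split; first exact: S.
- exists z, x; rewrite cycle_edges_swap cycle_edges_swapr cycle_edges_swapl.
  by split; first exact: S.
Qed.

(** A subgraph K_{2,3}, not necessarily induced, with sides {p, q} and {r1, r2, r3}. *)
Definition theta (T : finType) (e : rel T) : Prop :=
  exists p q r1 r2 r3, [/\ p != q, uniq [:: r1; r2; r3],
    all (e p) [:: r1; r2; r3] & all (e q) [:: r1; r2; r3]].

Definition clique4 (T : finType) (e : rel T) : Prop :=
  exists a b c d,
    [/\ uniq [:: a; b; c; d], all (e a) [:: b; c; d], all (e b) [:: a; c; d],
        all (e c) [:: a; b; d] & all (e d) [:: a; b; c]].

(** Relabel the cycles as a b y1 t1 and a b y2 t2 along a common edge. If exactly one of y1 = y2 and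
    t1 = t2 holds, the cycles share a path of length two and form a K_{2,3}. If neither holds, the
    second common edge must be y1 t1 = t2 y2 traversed backwards, and the four vertices form a
    K_4. *)
Lemma squares_sharing_two_edges (T : finType) (e : rel T) x y z t x' y' z' t' :
    simple_graph e -> square4 e x y z t -> square4 e x' y' z' t' ->
    #|cycle_edges x y z t :&: cycle_edges x' y' z' t'| = 2%N ->
  theta e \/ clique4 e.
Proof.
move=> [se ie] sq sq' c2.
have /card_gt0P[E] : (0 < #|cycle_edges x y z t :&: cycle_edges x' y' z' t'|)%N.
  by rewrite c2.
rewrite inE => /andP[E1 E2].
have /edgeP[a [b [ab Eab]]] := subsetP (cycle_edges_sub se sq) _ E1.
rewrite Eab in E1 E2.
have [y1 [t1 [s1 c1]]] := square4_through se sq E1.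
have [y2 [t2 [s2 c2']]] := square4_through se sq' E2.
move: c2; rewrite -c1 -c2' => c2 {c1 c2' sq sq' E E1 E2 Eab}.
have [/and3P[n1 n2 n3] n4 n5 n6] := square4_neq ie s1.
have [/and3P[m1 m2 m3] m4 m5 m6] := square4_neq ie s2.
have /and5P[_ _ _ by1 /andP[y1t1 t1a]] := s1.
have /and5P[_ _ _ by2 /andP[y2t2 t2a]] := s2.
have [y12|y12] := eqVneq y1 y2; have [t12|t12] := eqVneq t1 t2.
- move: c2; rewrite y12 t12 setIid (card_cycle_edges ie s2) => //.
- left; exists a, y1, b, t1, t2.
  rewrite /= !inE n1 (negPf n2) (negPf m2) t12 ab (se a t1) t1a (se a t2) t2a.
  by rewrite (se y1 b) by1 y1t1 y12 y2t2.
- left; exists b, t1, a, y1, y2.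
  rewrite /= !inE n2 (negPf n1) (negPf m1) y12 (se b a) ab by1 by2 t1a.
  by rewrite (se t1 y1) y1t1 t12 (se t2 y2) y2t2.
have [/andP[/eqP yt /eqP ty]|nK] := boolP ((y1 == t2) && (t1 == y2)).
  right; exists a, b, y1, t1.
  have y1a : e y1 a by rewrite yt.
  have bt1 : e b t1 by rewrite ty.
  rewrite /= !inE (neqF n3) (neqF n1) (neqF n6) (neqF n4) (neqF n2) (neqF n5).
  rewrite ab (se a y1) y1a (se a t1) t1a (se b a) ab by1 bt1 (se y1 b) by1 y1t1.
  by rewrite (se t1 b) bt1 (se t1 y1) y1t1.
have neqE := (neqF n1, neqF n2, neqF n3, neqF n4, neqF n5, neqF n6,
  neqF m1, neqF m2, neqF m3, neqF m4, neqF m5, neqF m6, neqF y12, neqF t12).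
(* In the remaining case the edge [[set a; b]] is the only common one, against the assumed two. *)
have /subset_leq_card : cycle_edges a y1 b t1 :&: cycle_edges a y2 b t2 \subset [set [set a; b]].
  apply/subsetP => E; rewrite in_setI => /andP[E1]; have := E1.
  rewrite {1}/cycle_edges in_set => E1'.
  have [u [w Euw]] : exists u w, E = [set u; w].
    by move: E1'; rewrite !inE => /or4P[] /eqP->; do 2!eexists.
  move: E1' => _; move: E1; rewrite in_set1 Euw set2_eq !in_cycle_edges.
  by case/orP=> /andP[/orP[]/eqP-> /orP[]/eqP->];
    rewrite ?eqxx ?neqE ?orbT ?andbT ?andbF ?orbF //=; move: nK;
    rewrite ?(eq_sym t1 y2) ?(eq_sym y1 t2); do ?case: (_ == _).
by rewrite c2 cards1.
Qed.

Definition cycle_of (T : finType) (p : T * T * (T * T)) : {set {set T}} :=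
  cycle_edges p.1.1 p.1.2 p.2.1 p.2.2.

(** The list [s] is the orbit of one labelling under the dihedral group of order 8. Another
    labelling of the same edge set is followed along three consecutive edges, which leaves no choice
    outside this list. *)
Lemma cycle_fiber (T : finType) (e : rel T) Z : irreflexive e ->
  (#|[set p in squares e | cycle_of p == Z]| <= 8)%N.
Proof.
move=> ie; have [->|[p0]] := set_0Vmem [set p in squares e | cycle_of p == Z].
  by rewrite cards0.
rewrite !inE => /andP[sq0 /eqP <-]; case: p0 sq0 => -[a b] [c d] /= sq0.
pose s := [:: (a, b, (c, d)); (a, b, (d, c)); (b, a, (c, d)); (b, a, (d, c));
              (c, d, (a, b)); (c, d, (b, a)); (d, c, (a, b)); (d, c, (b, a))].
apply: leq_trans (card_size s); apply: subset_leq_card; apply/subsetP => -[[x y] [z t]].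
rewrite !inE /= /cycle_of /= => /andP[sq /eqP cE].
have : [&& [set x; z] \in cycle_edges a b c d, [set z; y] \in cycle_edges a b c d
  & [set y; t] \in cycle_edges a b c d] by rewrite -cE !inE !eqxx !orbT.
have [/and3P[n1 n2 n3] n4 n5 n6] := square4_neq ie sq0.
have [/and3P[m1 m2 m3] m4 m5 m6] := square4_neq ie sq.
have neqE := (neqF n1, neqF n2, neqF n3, neqF n4, neqF n5, neqF n6).
rewrite !in_cycle_edges !xpair_eqE => /and3P[/orP[]/andP[/orP[]/eqP xE /orP[]/eqP zE]];
  subst x z; rewrite ?eqxx ?neqE ?orbT ?andbT ?andbF ?orbF /= in m1 m2 *;
  move=> /orP[]/eqP yE; subst y; rewrite ?eqxx // in m1 *;
  rewrite ?eqxx ?neqE ?orbT ?andbT ?andbF ?orbF /=;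
  by move=> /orP[]/eqP tE; subst t; rewrite ?eqxx ?neqE ?orbT //= in m2 *.
Qed.

Lemma card_squares_le (T : finType) (e : rel T) : irreflexive e ->
  (#|squares e| <= 8 * #|[set cycle_of p | p in squares e]|)%N.
Proof.
move=> ie; set Zs := [set cycle_of p | p in squares e].
rewrite -sum1_card (partition_big (@cycle_of T) (mem Zs)) /=.
  rewrite -sum1_card big_distrr /=; apply: leq_sum => Z _.
  by rewrite sum1dep_card muln1 cycle_fiber.
by move=> p pS; apply: imset_f.
Qed.

(** The 4-cycles give distinct nonzero vectors in a space of dimension at most 2 over F_2, which has
    at most three nonzero vectors. If three occur, each is the sum of the other two. *)
Lemma squares_bound (T : finType) (e : rel T) :
    simple_graph e -> connected_graph e -> #|edges e| = #|T|.+1 ->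
  (#|squares e| <= 16)%N \/ (#|squares e| <= 24)%N /\ (theta e \/ clique4 e).
Proof.
move=> [se ie] ce mE; set Zs := [set cycle_of p | p in squares e].
have rk : (\rank (kermx (incidence e)) <= 2)%N.
  apply: leq_trans (rank_cycle_space se ce) _; rewrite mE; lia.
have Q8 := card_squares_le ie; rewrite -/Zs in Q8.
have [Z2|Z3] := leqP #|Zs| 2; first by left; apply: leq_trans Q8 _; rewrite (leq_mul2l 8 _ 2).
right; pose v := edge_vector e.
have Zker Z : Z \in Zs -> [/\ (v Z <= kermx (incidence e))%MS, v Z != 0,
    Z \subset edges e & #|Z| = 4%N].
  case/imsetP=> p; rewrite inE => sq ->; split.
  - exact: cycle_vector_ker.
  - apply/eqP => v0; have := card_cycle_edges ie sq.
    suff -> : cycle_edges p.1.1 p.1.2 p.2.1 p.2.2 = set0 by rewrite cards0.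
    apply: (@edge_vector_inj _ e); rewrite ?sub0set ?cycle_edges_sub //.
    by rewrite -[LHS]/(v _) v0; apply/rowP => i; rewrite !mxE inE.
  - exact: cycle_edges_sub.
  - exact: card_cycle_edges sq.
have vinj : {in Zs &, injective v}.
  by move=> Z W /Zker[_ _ sZ _] /Zker[_ _ sW _]; apply: edge_vector_inj.
have /card_gt2P[A [B [C [[AZ BZ CZ] [AB BC CA]]]]] := Z3.
have [Ak A0 As A4] := Zker _ AZ; have [Bk B0 Bs B4] := Zker _ BZ.
have vAB : v A != v B by apply: contra AB => /eqP/vinj->.
have third Z : Z \in Zs -> Z != A -> Z != B -> v Z = v A + v B.
  move=> ZZ ZA ZB; have [Zk Z0 _ _] := Zker _ ZZ.
  case: (F2_plane rk Ak Bk Zk A0 B0 vAB Z0) => // /vinj; move/(_ ZZ).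
    by move/(_ AZ) => ZAE; rewrite ZAE eqxx in ZA.
  by move/(_ BZ) => ZBE; rewrite ZBE eqxx in ZB.
have vC : v C = v A + v B by apply: third; rewrite // eq_sym.
split.
  suff Zs3 : (#|Zs| <= 3)%N by apply: leq_trans Q8 _; rewrite (leq_mul2l 8 _ 3).
  apply: leq_trans (card_size [:: A; B; C]); apply: subset_leq_card; apply/subsetP => Z ZZ.
  rewrite !inE; have [//|ZA] := eqVneq Z A; have [//|ZB] := eqVneq Z B.
  by apply/eqP/vinj => //; rewrite vC third.
have [_ _ Cs C4] := Zker _ CZ.
have CE : C = (A :\: B) :|: (B :\: A).
  apply/setP => E; have [hE|nE] := boolP (E \in edges e); last first.
    by rewrite !inE (contraNF (subsetP As E) nE) (contraNF (subsetP Bs E) nE)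
               (contraNF (subsetP Cs E) nE).
  have /rowP/(_ (enum_rank_in hE E)) := vC.
  rewrite [RHS]mxE !edge_vectorE !inE.
  by case: (E \in A); case: (E \in B); case: (E \in C).
(* [C] is the symmetric difference of [A] and [B], and all three have four elements, so 4 = 4 + 4 -
   2 |A cap B|. *)
have AB2 : #|A :&: B| = 2%N.
  have := cardsID B A; have := cardsID A B; rewrite setIC A4 B4.
  have : #|C| = (#|A :\: B| + #|B :\: A|)%N.
    rewrite CE cardsU; suff -> : (A :\: B) :&: (B :\: A) = set0 by rewrite cards0 subn0.
    by apply/setP => E; rewrite !inE; case: (E \in A); case: (E \in B).
  rewrite C4; move: #|A :&: B| #|A :\: B| #|B :\: A| => i j k; clear; lia.
case/imsetP: AZ AB2 => p; rewrite inE => sp ->; case/imsetP: BZ => q; rewrite inE => sq -> AB2.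
exact: squares_sharing_two_edges (conj se ie) sp sq AB2.
Qed.

Lemma excess_absurd (R : realFieldType) (n q s c : R) :
  n + 16/25 - 4/125 * q + s <= n -> q <= 24 -> c <= s -> 16/125 < c -> False.
Proof. by lra. Qed.

(** * Bicyclic graphs *)

Lemma bicyclic_edges (T : finType) (e : rel T) :
  bicyclic e -> #|edges e| = #|T|.+1.
Proof. by case=> _ _; rewrite /cyclomatic_number; lia. Qed.

Lemma bicyclic_sum_degree (T : finType) (e : rel T) :
  bicyclic e -> (\sum_x degree e x = (2 * #|T|).+2)%N.
Proof.
by move=> bi; case: (bi) => sg _ _; rewrite sum_degree // bicyclic_edges // mulnS.
Qed.

(** By connectedness an isolated vertex would be the whole graph, with degree sum 0 instead of 4. *)
Lemma bicyclic_degree_gt0 (T : finType) (e : rel T) x :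
  bicyclic e -> (0 < degree e x)%N.
Proof.
move=> bi; case: (bi) => -[se ie] ce _; rewrite lt0n; apply/eqP => dx0.
have Tx : [set x] = [set: T].
  apply: (connected_closed (x := x) se ce); first by rewrite inE.
  move=> y z; rewrite inE => /eqP-> xz.
  by move: dx0 => /eqP; rewrite cards_eq0 => /eqP/setP/(_ z); rewrite !inE xz.
move: (bicyclic_sum_degree bi); rewrite -cardsT -Tx cards1.
rewrite (eq_bigl (mem [set x])) => [|y]; first by rewrite big_set1 dx0.
by have := in_setT y; rewrite -Tx /= => ->.
Qed.

(* Otherwise the graph would be the star with three leaves. *)
Lemma bicyclic_leaf_degree_lt3 (T : finType) (e : rel T) x :
  bicyclic e -> (degree e x <= 3)%N -> (leaf_degree e x < 3)%N.
Proof.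
move=> bi d3; case: (bi) => -[se ie] ce _; rewrite ltnNge; apply/negP => lx3.
have [dx lE] : degree e x = 3%N /\ leaf_degree e x = 3%N.
  by have := degree_split e x; lia.
have nb : [set y | e x y && leaf e y] = [set y | e x y].
  apply/eqP; rewrite eqEcard; apply/andP; split.
    by apply/subsetP => y; rewrite !inE => /andP[].
  by rewrite -/(degree e x) -/(leaf_degree e x) dx lE.
have nl y : e x y -> leaf e y.
  by move=> xy; have /setP/(_ y) := nb; rewrite !inE xy.
have TE : x |: [set y | e x y] = [set: T].
  apply: (connected_closed (x := x) se ce); first by rewrite setU11.
  move=> y z; rewrite !inE => /orP[/eqP-> ->|xy yz]; first by rewrite orbT.
  have /cards1P[u yu] := nl _ xy.
  have : x \in [set z | e y z] by rewrite inE se.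
  have : z \in [set z | e y z] by rewrite inE.
  by rewrite yu !inE => /eqP-> /eqP->; rewrite eqxx.
have xN : x \notin [set y | e x y] by rewrite inE ie.
have n4 : #|T| = 4%N by rewrite -cardsT -TE cardsU1 xN -/(degree e x) dx.
(* The star has degree sum 3 + 3 = 6, while a bicyclic graph on four vertices has 10. *)
move: (bicyclic_sum_degree bi); rewrite n4 (bigD1 x) //= dx.
rewrite (eq_bigl (e x)) => [|y]; last first.
  by have := in_setT y; rewrite -TE !inE; case: eqP => //= ->; rewrite ie.
rewrite (eq_bigr (fun=> 1%N)) => [|y]; last by move=> /nl/eqP.
by rewrite sum1dep_card -/(degree e x) dx.
Qed.

(** All degrees are 2 or 3 and sum to 2n + 2, so exactly two vertices have degree 3. A K_4 would
    need four of them. In a K_{2,3} they are [p] and [q], so none of its five vertices has further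
    neighbors and connectedness makes it the whole graph. *)
Lemma leafless_bicyclic_order (T : finType) (e : rel T) :
    bicyclic e -> (forall x, degree e x <= 3)%N -> (forall x, ~~ leaf e x) ->
  theta e \/ clique4 e -> #|T| = 5%N.
Proof.
move=> bi deg_le nleaf; case: (bi) => -[se ie] ce _.
have deg23 x : degree e x = (2 + (degree e x == 3))%N.
  have := nleaf x; have := deg_le x; have := bicyclic_degree_gt0 x bi.
  by rewrite /leaf; move: (degree e x) => [|[|[|[|d]]]].
pose D := [set x | degree e x == 3%N].
have D2 : #|D| = 2%N.
  have -> : #|D| = (\sum_x (degree e x == 3%N))%N.
    by rewrite -sum1dep_card big_mkcond; apply: eq_bigr => x _; case: eqP.
  move: (bicyclic_sum_degree bi).
  rewrite (eq_bigr _ (fun x _ => deg23 x)) big_split sum_nat_const /= mulnC => sumE.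
  by apply: (@addnI (2 * #|T|)%N); rewrite sumE addn2.
have D_of x (s : seq T) : uniq s -> size s = 3%N -> all (e x) s ->
    x \in D /\ [set y | e x y] = [set y in s].
  move=> us s3 es.
  have sub : [set y in s] \subset [set y | e x y].
    by apply/subsetP => y; rewrite !inE => /(allP es).
  have cs : #|[set y in s]| = 3%N by rewrite cardsE (card_uniqP us).
  have dx : degree e x = 3%N.
    by apply/eqP; rewrite eqn_leq deg_le /= -cs subset_leq_card.
  split; first by rewrite inE dx.
  by apply/esym/eqP; rewrite eqEcard sub cs -/(degree e x) dx.
case=> [[p [q [r1 [r2 [r3 [pq ur ap aq]]]]]]|[a [b [c [d [u4 aa ab ac ad]]]]]].
  have [pD Np] := D_of _ _ ur erefl ap; have [qD Nq] := D_of _ _ ur erefl aq.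
  have DE : D = [set p; q].
    apply/esym/eqP; rewrite eqEcard cards2 pq D2 andbT.
    by apply/subsetP => y; rewrite !inE => /orP[]/eqP->; [move: pD|move: qD]; rewrite inE.
  have Nr r : r \in [:: r1; r2; r3] -> [set y | e r y] = [set p; q].
    move=> rs; apply/esym/eqP; rewrite eqEcard cards2 pq -/(degree e r).
    have pr := allP ap _ rs; have qr := allP aq _ rs.
    apply/andP; split.
      by apply/subsetP => y; rewrite !inE => /orP[]/eqP->; rewrite se.
    have : r \notin D.
      by rewrite DE !inE negb_or; apply/andP; split; apply/eqP => rE;
         [move: pr | move: qr]; rewrite rE ie.
    by rewrite inE => /negPf nr; rewrite deg23 nr.
  have TE : [set p; q] :|: [set y in [:: r1; r2; r3]] = [set: T].
    apply: (connected_closed (x := p) se ce); first by rewrite !inE eqxx.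
    move=> y z; rewrite in_setU => /orP[].
      rewrite in_set2 => /orP[]/eqP-> yz; rewrite in_setU; apply/orP; right.
        by rewrite -Np inE.
      by rewrite -Nq inE.
    by rewrite inE => /Nr yE yz; rewrite in_setU -yE inE yz.
  rewrite -cardsT -TE cardsU cards2 pq cardsE (card_uniqP ur) /=.
  suff -> : [set p; q] :&: [set y in [:: r1; r2; r3]] = set0 by rewrite cards0.
  apply/setP => y; rewrite in_setI in_set0; apply/negP => /andP[].
  by rewrite in_set2 => /orP[]/eqP->; [rewrite -Np|rewrite -Nq]; rewrite inE ie.
have : [set x in [:: a; b; c; d]] \subset D.
  have ua : uniq [:: b; c; d] by case/andP: u4.
  move: u4; rewrite /= !inE !negb_or => /and4P[/and3P[n1 n2 n3] /andP[n4 n5] n6 _].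
  apply/subsetP => x; rewrite inE !in_cons in_nil orbF => /or4P[] /eqP->.
  - exact: (D_of _ _ _ _ aa).1.
  - by apply: (D_of _ _ _ _ ab).1; rewrite //= !inE !negb_or n2 n3 n6.
  - by apply: (D_of _ _ _ _ ac).1; rewrite //= !inE !negb_or n1 n3 n5.
  - by apply: (D_of _ _ _ _ ad).1; rewrite //= !inE !negb_or n1 n2 n4.
by move/subset_leq_card; rewrite D2 cardsE (card_uniqP u4).
Qed.

Lemma bicyclic_energy_neq_order (T : finType) (e : rel T) :
  bicyclic e -> (max_degree e <= 3)%N -> energy e <> #|T|%:R.
Proof.
move=> bi d3 En; case: (bi) => sg ce _; have [se _] := sg.
have deg_le x : (degree e x <= 3)%N.
  by apply: leq_trans d3; apply: (leq_bigmax (F := degree e)).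
have bounds x := @charge_bounds T e x
  (introT andP (conj (bicyclic_degree_gt0 x bi) (deg_le x))).
have sum_ge0 (P : pred T) : 0 <= \sum_(x | P x) charge e x.
  by apply: sumr_ge0 => x _; case: (bounds x).
have := energy_ge_charge se deg_le (bicyclic_sum_degree bi).
rewrite En -(ratr_nat algC) ler_rat => low.
case: (squares_bound sg ce (bicyclic_edges bi)) => [Q16|[Q24 str]].
  (* Here 16/25 - 16 * 4/125 = 16/125 is positive, which contradicts [low]. *)
  have Q : #|squares e|%:R <= 16 :> rat by rewrite (ler_nat _ _ 16).
  have := sum_ge0 predT; lra.
have Q : #|squares e|%:R <= 24 :> rat by rewrite (ler_nat _ _ 24).
(* A single vertex next to a leaf outweighs the deficit 16/125, as the other charges are
   nonnegative. *)
have leaf_degree0 x : leaf_degree e x = 0%N.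
  apply/eqP; rewrite eqn0Ngt; apply/negP => lx.
  have := (bounds x).2; rewrite lx (bicyclic_leaf_degree_lt3 bi (deg_le x)) => /(_ isT) cx.
  have xs : charge e x <= \sum_y charge e y.
    by rewrite (bigD1 x (isT : predT x)) lerDl; apply: sum_ge0.
  exact: excess_absurd low Q xs cx.
have nleaf x : ~~ leaf e x.
  apply/negP => lx; have /card_gt0P[y] := bicyclic_degree_gt0 x bi; rewrite inE => xy.
  have : (0 < leaf_degree e y)%N by apply/card_gt0P; exists x; rewrite inE se xy.
  by rewrite leaf_degree0.
have n5 := leafless_bicyclic_order bi deg_le nleaf str.
by have := energy_even sg En; rewrite n5.
Qed.

Theorem theorem2p7 :
  ~ exists (T : finType) (e : rel T),
      [/\ bicyclic e, (max_degree e <= 3)%N & energy e = #|T|%:R].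
Proof. by case=> T [e [bi d3]]; apply: bicyclic_energy_neq_order. Qed.
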